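(* Suppose the noise condition $\mathbb P_X(0<\Delta(X)\le\delta)\le(\gamma\delta/B)^\alpha$ for all $\delta>0$ holds for some $\alpha,\gamma\ge0$, and suppose that, for universal constants $C_1,C_2$ and a sequence $a_n>0$, the (data-dependent) estimator $\hat f$ satisfies, for every $\delta>0$ and almost every $x$, $$\mathbb P(\|\hat{f}(x) - f^*(x)\|\ge \delta)\le C_1 \exp(- C_2 a_n \delta^2).$$ Then, for a constant $C(\alpha,\gamma)$ depending only on $\alpha,\gamma$, $$\mathrm{Regret}(\pi_{\hat{f}}) \le C(\alpha, \gamma)\, B\, a_n^{-\frac{1+\alpha}{2}}.$$
   Context: Setting: $X\in\mathbb R^p$, $Y\in\mathbb R^d$ with $\|Y\|\le1$, $f^*(x)=\mathbb E[Y\mid X=x]$. $\mathcal Z=\{z:Az\le b\}$ is a polytope with $\sup_{z\in\mathcal Z}\|z\|\le B$ and finite set of extreme points $\mathcal Z^\angle$; $\mathcal Z^*(x)=\arg\min_{z\in\mathcal Z}f^*(x)^\top z$, $\pi^*(x)\in\mathcal Z^*(x)$; $\Delta(x)=\inf_{z\in\mathcal Z^\angle\setminus\mathcal Z^*(x)}f^*(x)^\top z-\inf_{z\in\mathcal Z}f^*(x)^\top z$ if $\mathcal Z^*(x)\ne\mathcal Z$, else $0$. Data $\mathcal D$ are $n$ i.i.d. draws of $(X,Y)$; $\mathrm{Regret}(\hat\pi)=\mathbb E_{\mathcal D}\mathbb E_X[f^*(X)^\top(\hat\pi(X)-\pi^*(X))]$, $X$ an independent new draw. For $f$, the plug-in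 policy $\pi_f(x)\in\arg\min_{z\in\mathcal Z}f(x)^\top z$ is chosen in $\mathcal Z^\angle$ with ties broken by a fixed ordering of $\mathcal Z^\angle$. *)

(* Defs.v *)
From HB Require Import structures.
From mathcomp Require Import all_boot all_order all_algebra.
From mathcomp Require Import all_classical all_reals all_analysis.
Set Implicit Arguments. Unset Strict Implicit. Unset Printing Implicit Defensive.
Import Order.TTheory GRing.Theory Num.Theory.
Local Open Scope classical_set_scope.
Local Open Scope ring_scope.

(* Vectors of R^k are represented as k.-tuple R, which carries the product
   (Borel) sigma-algebra generated by the coordinate projections. *)

Section vectors.
Variable R : realType.

Definition dotp (k : nat) (u v : k.-tuple R) : R :=
  \sum_(i < k) tnth u i * tnth v i.

Definition vsub (k : nat) (u v : k.-tuple R) : k.-tuple R :=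
  [tuple tnth u i - tnth v i | i < k].

Definition enorm (k : nat) (u : k.-tuple R) : R :=
  Num.sqrt (\sum_(i < k) tnth u i ^+ 2).

Definition vcomb (k : nat) (t : R) (u v : k.-tuple R) : k.-tuple R :=
  [tuple t * tnth u i + (1 - t) * tnth v i | i < k].

Definition polytope (m k : nat) (A : 'M[R]_(m, k)) (b : 'I_m -> R)
  : set (k.-tuple R) :=
  [set z | forall i : 'I_m, \sum_(j < k) A i j * tnth z j <= b i].

Definition extreme_point (k : nat) (S : set (k.-tuple R)) (z : k.-tuple R) :=
  S z /\ forall (u v : k.-tuple R) (t : R), S u -> S v -> 0 < t < 1 ->
    z = vcomb t u v -> u = z /\ v = z.

Definition argmin_set (k : nat) (S : set (k.-tuple R)) (c : k.-tuple R)
  : set (k.-tuple R) :=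
  [set z | S z /\ forall z', S z' -> dotp c z <= dotp c z'].

Definition gap (k : nat) (S : set (k.-tuple R)) (ext : seq (k.-tuple R))
  (c : k.-tuple R) : R :=
  if `[< argmin_set S c = S >] then 0
  else inf [set dotp c z | z in [set z | z \in ext /\ ~ argmin_set S c z]]
       - inf [set dotp c z | z in S].

(* plug-in policy: the first element (in the fixed ordering ext of the
   extreme points) lying in argmin_{z in S} c^T z *)
Definition plugin (k : nat) (S : set (k.-tuple R)) (ext : seq (k.-tuple R))
  (c : k.-tuple R) : k.-tuple R :=
  nth [tuple of nseq k 0] ext
      (find (fun z => `[< argmin_set S c z >]) ext).

End vectors.

Section probability_defs.
Local Open Scope ereal_scope.

Definition mutually_independent d0 (Omega : measurableType d0) (R : realType)
  (P : probability Omega R) (I : finType) d' (T : measurableType d')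
  (W : I -> Omega -> T) : Prop :=
  forall B : I -> set T, (forall i, measurable (B i)) ->
    P (\bigcap_(i in [set: I]) (W i @^-1` B i)) =
    \prod_(i : I) P (W i @^-1` B i).

Definition is_cond_exp d0 (Omega : measurableType d0) (R : realType)
  (P : probability Omega R) (p k : nat)
  (X : Omega -> p.-tuple R) (Y : Omega -> k.-tuple R)
  (fstar : p.-tuple R -> k.-tuple R) : Prop :=
  measurable_fun [set: p.-tuple R] fstar /\
  forall (A : set (p.-tuple R)), measurable A -> forall j : 'I_k,
    \int[P]_(w in X @^-1` A) (tnth (Y w) j)%:E =
    \int[P]_(w in X @^-1` A) (tnth (fstar (X w)) j)%:E.

End probability_defs.

(* Main.v *)
(* Write t = a^(-1/2), and let e be the estimation error at the new point X.
   The plug-in policy minimizes the estimated cost, so by Cauchy-Schwarz its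
   regret is at most 2 B e; being an extreme point, it has either zero regret or
   regret at least the gap, in which case 0 < gap <= 2 B e. Peeling over the
   value k of the integer part of e / t, the regret is at most
     sum_k 2 B (k+1) t 1{e >= k t} 1{0 < gap <= 2 B (k+1) t}.
   Since the data are independent of X, the expectation of the k-th term is at
   most 2 B (k+1) t (C1 + 1) exp (- C2 k^2) (2 gamma (k+1) t)^alpha, which
   leaves t^(1+alpha) times a convergent series. *)
Require Import Defs.
From HB Require Import structures.
From mathcomp Require Import all_boot all_order all_algebra.
From mathcomp Require Import all_classical all_reals all_analysis.
From mathcomp Require Import measurable_realfun ring lra.
Import Order.TTheory GRing.Theory Num.Theory.
Local Open Scope classical_set_scope.
Local Open Scope ring_scope.
Set Implicit Arguments. Unset Strict Implicit. Unset Printing Implicit Defensive.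

(** * Euclidean inner product and norm on tuples *)

Section euclidean.
Context {R : realType} {k : nat}.
Implicit Types u v c z : k.-tuple R.

Lemma dotp_vsubr c u v : dotp c (vsub u v) = dotp c u - dotp c v.
Proof.
rewrite /dotp -sumrB; apply: eq_bigr => i _.
by rewrite tnth_mktuple mulrBr.
Qed.

Lemma dotp_vsubl u v z : dotp (vsub u v) z = dotp u z - dotp v z.
Proof.
rewrite /dotp -sumrB; apply: eq_bigr => i _.
by rewrite tnth_mktuple mulrBl.
Qed.

Lemma enorm_ge0 u : 0 <= enorm u.
Proof. exact: sqrtr_ge0. Qed.

Lemma enorm_sqr u : enorm u ^+ 2 = \sum_(i < k) tnth u i ^+ 2.
Proof. by rewrite sqr_sqrtr// sumr_ge0// => i _; exact: sqr_ge0. Qed.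

Lemma ler_tnth_enorm u (i : 'I_k) : `|tnth u i| <= enorm u.
Proof.
rewrite -ler_sqr ?nnegrE ?enorm_ge0// enorm_sqr real_normK ?num_real//.
by rewrite (bigD1 i)//= lerDl sumr_ge0// => j _; exact: sqr_ge0.
Qed.

Lemma dotp_le_enorm u v : `|dotp u v| <= enorm u * enorm v.
Proof.
rewrite -ler_sqr ?nnegrE ?mulr_ge0 ?enorm_ge0// exprMn !enorm_sqr.
rewrite real_normK ?num_real// /dotp expr2.
set x := fun i => tnth u i; set y := fun i => tnth v i.
(* Lagrange's identity *)
have : 0 <= \sum_(i < k) \sum_(j < k) (x i * y j - x j * y i) ^+ 2.
  by apply: sumr_ge0 => i _; apply: sumr_ge0 => j _; exact: sqr_ge0.
have -> : \sum_(i < k) \sum_(j < k) (x i * y j - x j * y i) ^+ 2 =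
    ((\sum_(i < k) x i ^+ 2) * (\sum_(i < k) y i ^+ 2)) *+ 2 -
    ((\sum_(i < k) x i * y i) * (\sum_(i < k) x i * y i)) *+ 2.
  transitivity (\sum_(i < k) \sum_(j < k) x i ^+ 2 * y j ^+ 2
     + \sum_(i < k) \sum_(j < k) x j ^+ 2 * y i ^+ 2
     - (\sum_(i < k) \sum_(j < k) (x i * y i) * (x j * y j)) *+ 2).
    rewrite mulr2n opprD addrA -!sumrN -!big_split/=; apply: eq_bigr => i _.
    rewrite -!sumrN -!big_split/=; apply: eq_bigr => j _; ring.
  have -> : \sum_(i < k) \sum_(j < k) x j ^+ 2 * y i ^+ 2 =
      \sum_(i < k) \sum_(j < k) x i ^+ 2 * y j ^+ 2 by exact: exchange_big.
  by rewrite -!big_distrlr/= mulr2n.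
by rewrite subr_ge0 ler_pMn2r.
Qed.

End euclidean.

(** * Linear minimization over a bounded polytope reaches an extreme point *)

Section polytopes.
Context {R : realType} {m k : nat} (A : 'M[R]_(m, k)) (b : 'I_m -> R) (B : R).
Local Notation S := (polytope A b).
Hypothesis S_bounded : forall z, S z -> enorm z <= B.

Let row_dot (i : 'I_m) (z : k.-tuple R) := \sum_(j < k) A i j * tnth z j.

Let move (z e : k.-tuple R) (s : R) : k.-tuple R :=
  [tuple tnth z j + s * tnth e j | j < k].

Let row_dot_move i z e s : row_dot i (move z e s) = row_dot i z + s * row_dot i e.
Proof.
rewrite /row_dot mulr_sumr -big_split/=; apply: eq_bigr => j _.
by rewrite tnth_mktuple; ring.
Qed.

Let dotp_move c z e s : dotp c (move z e s) = dotp c z + s * dotp c e.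
Proof.
rewrite /dotp mulr_sumr -big_split/=; apply: eq_bigr => j _.
by rewrite tnth_mktuple; ring.
Qed.

(** Otherwise the whole ray from [z] along [e] would stay in [S], against boundedness. *)
Let blocking_row z e j : S z -> tnth e j != 0 -> exists i, 0 < row_dot i e.
Proof.
move=> Sz ej0; apply: contrapT => noi.
have ej : 0 < `|tnth e j| by rewrite normr_gt0.
(* Coordinate [j] moves by [B + |z_j| + 1], so its absolute value ends up above [B]. *)
pose s := (B + `|tnth z j| + 1) / `|tnth e j|.
have B0 : 0 <= B by rewrite (le_trans _ (S_bounded Sz))// enorm_ge0.
have s0 : 0 <= s by rewrite divr_ge0// ?addr_ge0.
have Sm : S (move z e s).
  move=> i; rewrite -/(row_dot i _) row_dot_move.
  have re : row_dot i e <= 0 by rewrite leNgt; apply/negP => ?; apply: noi; exists i.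
  by have := Sz i; rewrite -/(row_dot i z); have := mulr_ge0_le0 s0 re; lra.
have := le_trans (ler_tnth_enorm _ j) (S_bounded Sm).
rewrite tnth_mktuple => le1.
have : `|s * tnth e j| <= `|tnth z j + s * tnth e j| + `|tnth z j|.
  have := ler_normB (tnth z j + s * tnth e j) (tnth z j).
  by rewrite addrAC subrr add0r.
rewrite normrM (ger0_norm s0) /s divfK ?gt_eqF//; lra.
Qed.

Let tight z := [set i : 'I_m | row_dot i z == b i]%SET.

(* Sliding along e until a new constraint becomes tight. *)
Let slide z e j c : S z -> tnth e j != 0 -> dotp c e <= 0 ->
  (forall i, i \in tight z -> row_dot i e = 0) ->
  exists z', [/\ S z', dotp c z' <= dotp c z & (tight z \proper tight z')%SET].
Proof.
move=> Sz ej ce te; have [i1 i1e] := blocking_row Sz ej.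
pose ratio i := (b i - row_dot i z) / row_dot i e.
(* Ratio test: [i0] is the first constraint met when leaving [z] along [e]. Tight rows have slope
   zero along [e] and stay tight, while [i0] has positive slope and is therefore new. *)
case: (arg_minP ratio (i1e : (fun i => 0 < row_dot i e) i1)) => i0 i0e i0min.
have s0 : 0 <= ratio i0 by rewrite divr_ge0 ?(ltW i0e)// subr_ge0; exact: Sz.
exists (move z e (ratio i0)); split.
- move=> i; rewrite -/(row_dot i _) row_dot_move.
  have := Sz i; rewrite -/(row_dot i z) => Szi.
  have [ie|ie] := ltP 0 (row_dot i e).
    by have := i0min _ ie; rewrite {2}/ratio ler_pdivlMr//; lra.
  by have := mulr_ge0_le0 s0 ie; lra.
- by rewrite dotp_move; have := mulr_ge0_le0 s0 ce; lra.
- apply/properP; split.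
    apply/fintype.subsetP => i it; rewrite inE row_dot_move (te _ it) mulr0 addr0.
    by move: it; rewrite inE.
  exists i0; first by rewrite inE row_dot_move /ratio divfK ?(gt_eqF i0e)// addrC subrK.
  by apply/negP => /te i00; rewrite i00 ltxx in i0e.
Qed.

(** Write [z] as a strict convex combination of distinct [u], [v] in [S] and take [e = u - v]. A row
    tight at [z] is at most [b i] at [u] and [v] and equals it at their average, so it takes the
    same value at both. *)
Let not_extreme_dir z : S z -> ~ extreme_point S z ->
  exists e j, tnth e j != 0 /\ forall i, i \in tight z -> row_dot i e = 0.
Proof.
move=> Sz nex.
have [u [v [t [Su Sv t01 zE ne]]]] :
    exists u v t, [/\ S u, S v, 0 < t < 1, z = vcomb t u v & ~ (u = z /\ v = z)].
  apply: contrapT => nuv; apply: nex; split=> // u v t Su Sv t01 zE.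
  by apply: contrapT => ne; apply: nuv; exists u, v, t.
have uv : u != v.
  apply/eqP => uv; apply: ne; subst v; split; rewrite zE; apply: eq_from_tnth => j;
  by rewrite tnth_mktuple; ring.
have [j euv] : exists j, tnth u j != tnth v j.
  apply: contrapT => nj; move/eqP: uv; apply; apply: eq_from_tnth => j.
  by apply/eqP/negPn/negP => ?; apply: nj; exists j.
exists (vsub u v), j; split; first by rewrite tnth_mktuple subr_eq0.
move=> i; rewrite inE => /eqP ti.
have rz : row_dot i z = t * row_dot i u + (1 - t) * row_dot i v.
  rewrite /row_dot !mulr_sumr -big_split/=; apply: eq_bigr => l _.
  by rewrite zE tnth_mktuple; ring.
have -> : row_dot i (vsub u v) = row_dot i u - row_dot i v.
  by rewrite /row_dot -sumrB; apply: eq_bigr => l _; rewrite tnth_mktuple; ring.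
have := Su i; have := Sv i; rewrite -/(row_dot i u) -/(row_dot i v) => h1 h2.
case/andP: t01 => t0 t1; rewrite rz in ti; apply/eqP; rewrite eq_le; apply/andP; split; nra.
Qed.

(** Induction on the number of constraints that are not tight: from a point that is not extreme,
    slide along a direction of non-increasing cost until one more constraint becomes tight. *)
Lemma polytope_extreme_le c z : S z ->
  exists2 v, extreme_point S v & dotp c v <= dotp c z.
Proof.
have [n] := ubnP #|~: tight z|; elim: n z => // n IH z; rewrite ltnS => nz Sz.
have [ez|nez] := pselect (extreme_point S z); first by exists z.
have [e [j [ej te]]] := not_extreme_dir Sz nez.
(* If [e] increases the cost, [-e] serves instead; it is written as a move from the origin. *)
have [e' [ej' te' ce']] : exists e', [/\ tnth e' j != 0,
    forall i, i \in tight z -> row_dot i e' = 0 & dotp c e' <= 0].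
  have [ce|ce] := leP (dotp c e) 0; first by exists e.
  exists (move [tuple 0 | l < k] e (-1)); split.
  - by rewrite !tnth_mktuple add0r mulN1r oppr_eq0.
  - move=> i it; rewrite row_dot_move te// mulr0 addr0 /row_dot big1// => l _.
    by rewrite tnth_mktuple mulr0.
  - rewrite dotp_move /dotp big1 => [|l _]; last by rewrite tnth_mktuple mulr0.
    by rewrite add0r mulN1r oppr_le0 ltW.
have [z' [Sz' cz' tz']] := slide Sz ej' ce' te'.
have [|v ev cv] := IH z' _ Sz'; last by exists v => //; exact: le_trans cz'.
by apply: leq_trans nz; apply: proper_card; rewrite properC.
Qed.

End polytopes.

Lemma seq_argmin {R : realType} {T : eqType} (f : T -> R) (s : seq T) :
  s != [::] -> exists2 x, x \in s & forall y, y \in s -> f x <= f y.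
Proof.
elim: s => // x [|x' s] IH _.
  by exists x => [|y]; rewrite ?mem_head// inE => /eqP ->.
have [//|u us umin] := IH.
have [xu|/ltW ux] := leP (f x) (f u).
  exists x => [|y]; first exact: mem_head.
  by rewrite in_cons => /predU1P[->//|/umin]; exact: le_trans.
exists u => [|y]; first by rewrite in_cons us orbT.
by rewrite in_cons => /predU1P[->//|/umin].
Qed.

Lemma inf_attained {R : realType} (D : set R) x :
  D x -> (forall y, D y -> x <= y) -> inf D = x.
Proof.
move=> Dx xD; apply/eqP; rewrite eq_le; apply/andP; split.
  by apply: ge_inf => //; exists x.
by apply: lb_le_inf => //; exists x.
Qed.

(** * Optimality gap and regret of the plug-in policy *)

Section plugin_policy.
Context {R : realType} {m k : nat} (A : 'M[R]_(m, k)) (b : 'I_m -> R) (B : R)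
  (ext : seq (k.-tuple R)).
Local Notation S := (polytope A b).
Hypothesis S_bounded : forall z, S z -> enorm z <= B.
Hypothesis extP : forall z, z \in ext <-> extreme_point S z.
Hypothesis S_neq0 : exists z, S z.

Let ext_sub z : z \in ext -> S z. Proof. by move=> /extP[]. Qed.

Let ext_le c z : S z -> exists2 v, v \in ext & dotp c v <= dotp c z.
Proof.
by move=> /(polytope_extreme_le S_bounded c)[v /extP vext cv]; exists v.
Qed.

(** A finite boolean test replacing [argmin_set] on extreme points; unlike a quantification over all
    of [S], it is visibly measurable in [c]. *)
Definition opt_ext c z := all (fun z' => dotp c z <= dotp c z') ext.

Lemma opt_extP c z : z \in ext -> reflect (argmin_set S c z) (opt_ext c z).
Proof.
move=> zext; apply: (iffP allP) => [h|[_ h] z' /ext_sub]; last exact: h.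
split=> [|z' /(ext_le c)[v /h cv]]; [exact: ext_sub|exact: le_trans].
Qed.

Lemma exists_opt_ext c : exists2 z, z \in ext & opt_ext c z.
Proof.
have [z0 Sz0] := S_neq0; have [v vext _] := ext_le c Sz0.
have [|z zext zmin] := @seq_argmin _ _ (dotp c) ext; first by case: ext vext.
by exists z => //; apply/allP.
Qed.

Lemma pluginE c :
  plugin S ext c = nth [tuple of nseq k 0] ext (find (opt_ext c) ext).
Proof.
rewrite /plugin; congr nth; apply: eq_in_find => z zext.
by apply/asboolP/idP => /opt_extP; apply.
Qed.

Let has_opt c : has (opt_ext c) ext.
Proof. by have [z ? ?] := exists_opt_ext c; apply/hasP; exists z. Qed.

Lemma plugin_ext c : plugin S ext c \in ext.
Proof. by rewrite pluginE mem_nth// -has_find has_opt. Qed.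

Lemma plugin_argmin c : argmin_set S c (plugin S ext c).
Proof. by apply/(opt_extP _ (plugin_ext c)); rewrite pluginE (nth_find _ (has_opt c)). Qed.

(* If every extreme point is optimal then, minimizing [- c], so is every point. *)
Let argmin_full c : (forall z, z \in ext -> opt_ext c z) -> argmin_set S c = S.
Proof.
move=> allopt; apply/seteqP; split=> z; first by case.
move=> Sz; split=> // z' Sz'.
pose nc := [tuple - tnth c i | i < k].
have ncE u : dotp nc u = - dotp c u.
  by rewrite /dotp -sumrN; apply: eq_bigr => i _; rewrite tnth_mktuple mulNr.
have [v vext] := ext_le nc Sz; rewrite !ncE lerN2 => zv.
have [v' v'ext v'z'] := ext_le c Sz'.
by rewrite (le_trans zv)// (le_trans _ v'z')//; exact: (allP (allopt _ vext)).
Qed.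

(** Both infima in [gap] are attained, the first at [z], the second at [zs]. *)
Lemma gapE c z zs : z \in ext -> ~~ opt_ext c z ->
    (forall y, y \in ext -> ~~ opt_ext c y -> dotp c z <= dotp c y) ->
    argmin_set S c zs ->
  gap S ext c = dotp c z - dotp c zs.
Proof.
move=> zext znopt zmin [Szs zsmin].
rewrite /gap asboolF; last first.
  move=> SE; move/negP: znopt; apply; apply/(opt_extP _ zext).
  by rewrite SE; exact: ext_sub.
congr (_ - _).
  apply: inf_attained; first by exists z => //; split=> //; apply/opt_extP.
  by move=> _ [y [yext ny] <-]; apply: zmin => //; apply/(opt_extP _ yext).
apply: inf_attained; first by exists zs.
by move=> _ [y Sy <-]; exact: zsmin.
Qed.

(** The gap is realized by the cheapest non-optimal extreme point [u], which costs at most as much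
    as [z]; if [u] were as cheap as [zs], it would be optimal. *)
Lemma gap_gt0_le c z zs : z \in ext -> ~~ opt_ext c z -> argmin_set S c zs ->
  0 < gap S ext c <= dotp c z - dotp c zs.
Proof.
move=> zext znopt czs.
pose s := [seq y <- ext | ~~ opt_ext c y].
have zs' : z \in s by rewrite mem_filter znopt.
have [|u] := @seq_argmin _ _ (dotp c) s; first by case: s zs'.
rewrite mem_filter => /andP[unopt uext] umin.
have {}umin y : y \in ext -> ~~ opt_ext c y -> dotp c u <= dotp c y.
  by move=> yext ny; apply: umin; rewrite mem_filter ny.
rewrite (gapE uext unopt umin czs); apply/andP; split; last by rewrite lerB// umin.
rewrite subr_gt0 ltNge; apply: contraNN unopt => uzs; apply/(opt_extP _ uext).
by split=> [|y Sy]; [exact: ext_sub|exact: le_trans uzs (czs.2 _ Sy)].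
Qed.

(** Turns the margin event into a finite boolean combination of comparisons of linear forms in [c],
    from which its measurability follows. *)
Lemma gap_itvE c d : (0 < gap S ext c <= d) =
  has (fun z => ~~ opt_ext c z &&
    has (fun z' => opt_ext c z' && (dotp c z - dotp c z' <= d)) ext) ext.
Proof.
apply/idP/hasP => [/andP[gap0 gapd]|[z zext /andP[nz /hasP[z' z'ext]]]]; last first.
  move=> /andP[/(opt_extP _ z'ext) oz' zz'].
  have /andP[g0 g1] := gap_gt0_le zext nz oz'.
  by rewrite g0 (le_trans g1).
pose s := [seq y <- ext | ~~ opt_ext c y].
have [s0|/(@seq_argmin _ _ (dotp c))[u]] := eqVneq s [::].
  move: gap0; rewrite /gap asboolT ?ltxx//; apply: argmin_full => z zext.
  apply: contraT => nz; have : z \in s by rewrite mem_filter nz.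
  by rewrite s0.
rewrite mem_filter => /andP[unopt uext] umin; exists u => //; rewrite unopt/=.
have [v vext vopt] := exists_opt_ext c; apply/hasP; exists v => //; rewrite vopt/=.
rewrite -(@gapE c u v)//; last exact/opt_extP.
by move=> y yext ny; apply: umin; rewrite mem_filter ny.
Qed.

(** Replace [c] by [c'] in both costs: the plug-in point is no worse than [zs] for [c'], and each
    replacement costs at most [B * enorm (vsub c' c)] by Cauchy-Schwarz. *)
Lemma regret_le c c' zs : argmin_set S c zs ->
  dotp c (vsub (plugin S ext c') zs) <= 2 * B * enorm (vsub c' c).
Proof.
move=> [Szs _]; have [] := plugin_argmin c'.
move: (plugin _ _ _) => z Sz zmin.
have le z' : S z' -> `|dotp (vsub c' c) z'| <= B * enorm (vsub c' c).
  move=> Sz'; rewrite (le_trans (dotp_le_enorm _ _))// mulrC ler_wpM2r ?enorm_ge0//.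
  exact: S_bounded.
have := le _ Sz; have := le _ Szs; rewrite !dotp_vsubl !dotp_vsubr.
rewrite !ler_norml => /andP[_ h1] /andP[h2 _]; have := zmin _ Szs; lra.
Qed.

Lemma regret_ge0 c z zs : argmin_set S c zs -> S z -> 0 <= dotp c (vsub z zs).
Proof. by move=> [_ h] Sz; rewrite dotp_vsubr subr_ge0; exact: h. Qed.

(** With positive regret the chosen extreme point is not optimal for [c], so the gap is at most the
    regret. *)
Lemma regret_gap c c' zs : argmin_set S c zs ->
  0 < dotp c (vsub (plugin S ext c') zs) ->
  0 < gap S ext c <= 2 * B * enorm (vsub c' c).
Proof.
move=> czs r0; have /andP[g0 gle] : 0 < gap S ext c <= dotp c (vsub (plugin S ext c') zs).
  rewrite dotp_vsubr; apply: gap_gt0_le => //; first exact: plugin_ext.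
  apply/negP => /(opt_extP _ (plugin_ext c'))[_ /(_ _ czs.1)].
  by move: r0; rewrite dotp_vsubr subr_gt0 ltNge => /negP.
by rewrite g0 (le_trans gle)// regret_le.
Qed.

End plugin_policy.

(** * Independence: product laws and conditioning on the new point *)

Section independence.
Local Open Scope ereal_scope.
Context d (Omega : measurableType d) (R : realType) (P : probability Omega R).

Lemma independent_product_distribution d1 d2 (T1 : measurableType d1)
    (T2 : measurableType d2) (U : {mfun Omega >-> T1}) (V : {mfun Omega >-> T2}) :
  (forall A B, measurable A -> measurable B ->
    P (U @^-1` A `&` V @^-1` B) = P (U @^-1` A) * P (V @^-1` B)) ->
  forall E, measurable E ->
    P ((fun w => (U w, V w)) @^-1` E) = (distribution P U \x distribution P V) E.
Proof.
move=> UV E mE.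
have mUV : measurable_fun setT (fun w => (U w, V w)).
  by apply: measurable_fun_pair; exact: measurable_funPT.
pose UVm : {mfun Omega >-> (T1 * T2)%type} :=
  HB.pack (fun w => (U w, V w)) (isMeasurableFun.Build _ _ _ _ _ mUV).
rewrite (@product_measure_unique _ _ _ _ _ _ _ (distribution P UVm))//.
Qed.

(** Under the product law, the probability is the integral over the law of [U] of the measure of the
    sections. The section at [x] has measure at most [q] for almost every [x] in [G] and is empty
    outside [G]. *)
Lemma independent_section_le d1 d2 (T1 : measurableType d1)
    (T2 : measurableType d2) (U : Omega -> T1) (V : Omega -> T2)
    (H : set (T1 * T2)) (G : set T1) (q : R) :
  measurable_fun setT U -> measurable_fun setT V ->
  (forall A B, measurable A -> measurable B ->
    P (U @^-1` A `&` V @^-1` B) = P (U @^-1` A) * P (V @^-1` B)) ->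
  measurable H -> measurable G -> (0 <= q)%R ->
  {ae pushforward P U, forall x, P [set w | H (x, V w)] <= q%:E} ->
  P [set w | G (U w) /\ H (U w, V w)] <= q%:E * P (U @^-1` G).
Proof.
move=> mU mV UV mH mG q0 Hq.
pose U' : {mfun Omega >-> T1} := HB.pack U (isMeasurableFun.Build _ _ _ _ _ mU).
pose V' : {mfun Omega >-> T2} := HB.pack V (isMeasurableFun.Build _ _ _ _ _ mV).
pose E := (G `*` setT) `&` H.
have mE : measurable E by apply: measurableI => //; exact: measurableX.
have -> : [set w | G (U w) /\ H (U w, V w)] = (fun w => (U' w, V' w)) @^-1` E.
  by apply/seteqP; split => w /=; rewrite /E/=; tauto.
rewrite (independent_product_distribution (U := U') (V := V'))//= /product_measure1/=.
have -> : q%:E * P (U @^-1` G) = \int[distribution P U']_x (q * \1_G x)%:E.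
  under eq_integral do rewrite EFinM.
  rewrite ge0_integralZl//; last exact/measurable_EFinP.
  by rewrite integral_indic// setIT.
apply: ae_ge0_le_integral => //.
- exact: measurable_fun_xsection.
- by move=> x _; rewrite lee_fin mulr_ge0// indicE.
- by apply/measurable_EFinP; apply: measurable_funM.
- have {}Hq : {ae distribution P U', forall x, P [set w | H (x, V w)] <= q%:E} by [].
  apply: filterS Hq => x Hx _ /=.
  rewrite indicE; have [/set_mem Gx|/negP nGx] := boolP (x \in G).
    rewrite mulr1; apply: le_trans Hx; rewrite /distribution /pushforward/=.
    apply: le_measure; rewrite ?inE.
    + rewrite -[X in measurable X]setTI.
      by apply: (mV measurableT); exact: measurable_xsection.
    + have := measurable_xsection x mH => /(mV measurableT); rewrite setTI.
      by congr (measurable _); apply/seteqP; split => w; rewrite /xsection/= inE.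
    + by move=> w; rewrite /xsection/= inE => -[].
  rewrite mulr0 (_ : xsection E x = set0) ?measure0//.
  apply/seteqP; split => // y; rewrite /xsection/= inE => -[[/= Gx _] _].
  by apply: nGx; rewrite inE.
Qed.

(* Rectangles generate the sigma-algebra of the tuple space and are stable
   under intersection. *)
Lemma mutually_independent_tuple d1 d2 (T : measurableType d1)
    (T' : measurableType d2) n (D : 'I_n -> Omega -> T) (W : Omega -> T)
    (h : T -> T') :
  (forall i, measurable_fun setT (D i)) -> measurable_fun setT W ->
  measurable_fun setT h ->
  mutually_independent P
    (fun o : option 'I_n => match o with Some i => D i | None => W end) ->
  forall A B, measurable A -> measurable B ->
    P ((h \o W) @^-1` A `&` (fun w => [tuple D i w | i < n]) @^-1` B) =
    P ((h \o W) @^-1` A) * P ((fun w => [tuple D i w | i < n]) @^-1` B).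
Proof.
move=> mD mW mh ind A B mA mB.
pose Dt w := [tuple D i w | i < n].
have mDt : measurable_fun setT Dt.
  apply/measurable_fun_tnthP => i; apply: eq_measurable_fun (mD i) => w _ /=.
  by rewrite tnth_mktuple.
have mhW : measurable_fun setT (h \o W) by exact: measurableT_comp.
have mhWA : measurable ((h \o W) @^-1` A).
  by rewrite -[X in measurable X]setTI; exact: mhW.
pose D' : {mfun Omega >-> n.-tuple T} :=
  HB.pack Dt (isMeasurableFun.Build _ _ _ _ _ mDt).
have Pfin : P ((h \o W) @^-1` A) \is a fin_num by exact: fin_num_measure.
pose r : {nonneg R} := NngNum (fine_ge0 (measure_ge0 P ((h \o W) @^-1` A))).
(* With [A] fixed, the two sides of the claim are finite measures in [B], namely [m1] and [m2]; it
   suffices to compare them on rectangles. *)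
pose m1 : {measure set (n.-tuple T) -> \bar R} := pushforward (mrestr P mhWA) D'.
pose m2 : {measure set (n.-tuple T) -> \bar R} := mscale r (distribution P D').
pose rect (F : 'I_n -> set T) : set (n.-tuple T) := [set t | forall i, F i (tnth t i)].
pose G : set (set (n.-tuple T)) :=
  [set E | exists2 F : 'I_n -> set T, (forall i, measurable (F i)) & E = rect F].
have mG : G `<=` measurable.
  move=> _ [F mF ->].
  have -> : rect F = \bigcap_(i in setT) ((@tnth n T)^~ i @^-1` F i).
    by apply/seteqP; split => [t Ft i _|t Ft i]; apply: Ft.
  apply: fin_bigcap_measurable => // i _.
  by rewrite -[X in measurable X]setTI; exact: measurable_tnth.
have GT : G setT.
  by exists (fun=> setT) => //; apply/seteqP; split.
suff : m1 mDt B = m2 B.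
  rewrite /m1 /m2 /= /mscale/= /pushforward /mrestr fineK// => <-.
  by rewrite setIC.
apply: (@g_sigma_algebra_measure_unique _ _ _ G mG (fun=> setT)) => //.
- by rewrite bigcup_const.
- move=> _ _ [F mF ->] [F' mF' ->]; exists (fun i => F i `&` F' i).
    by move=> i; exact: measurableI.
  apply/seteqP; split=> [t [tF tF'] i|t tFF]; first by split.
  by split=> i; case: (tFF i).
- move=> _ [F mF ->].
  (* Applied twice: with [Q] the preimage of [A] under [h] for the joint probability, and with [Q]
     the full set for the law of the data alone. *)
  have indF (Q : set T) : measurable Q ->
      P (W @^-1` Q `&` Dt @^-1` rect F) = P (W @^-1` Q) * \prod_(i < n) P (D i @^-1` F i).
    move=> mQ.
    have := ind (fun o => if o is Some i then F i else Q).
    rewrite (bigD1 None)//= (reindex_omap Some id)/=; last by case.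
    under eq_bigl do rewrite eqxx.
    move=> <-; last by case.
    congr (P _); apply/seteqP; split=> [w [Qw Fw] [i|] _//=|w Fw].
      by have := Fw i; rewrite tnth_mktuple.
    split; first exact: (Fw None).
    by move=> i; rewrite tnth_mktuple; exact: (Fw (Some i)).
  rewrite /m1 /m2 /= /mscale/= /distribution/= /pushforward /mrestr fineK//= setIC.
  have mhA : measurable (h @^-1` A) by rewrite -[X in measurable X]setTI; exact: mh.
  rewrite comp_preimage indF//; congr (_ * _).
  by have := indF setT measurableT; rewrite preimage_setT setTI probability_setT mul1e.
- move=> _; rewrite /m1/= /pushforward /mrestr preimage_setT setTI.
  by rewrite ltey_eq Pfin.
- suff -> : <<s G >> = measurable by [].
  apply/seteqP; split.
    by apply: smallest_sub => //; exact: sigma_algebra_measurable.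
  move=> C; apply: smallest_sub; first exact: smallest_sigma_algebra.
  (* A generator constrains one coordinate only: it is a rectangle with full sides elsewhere. *)
  rewrite -bigcup_seq => S [i _ [Q mQ <-]]; apply: sub_sigma_algebra.
  exists (fun j => if j == i then Q else setT) => [j|]; first by case: ifP.
  rewrite setTI; apply/seteqP; split => t /=.
    by move=> tQ j; case: ifPn => // /eqP ->.
  by move=> /(_ i); rewrite eqxx.
Qed.

End independence.

(** * Measurability of vector operations and of finite searches *)

Section measurability.
Context {d} {T : measurableType d} {R : realType} {k : nat}.
Implicit Types f g : T -> k.-tuple R.

Lemma measurable_tnth_comp f i : measurable_fun setT f ->
  measurable_fun setT (fun w => tnth (f w) i).
Proof. by move=> /measurable_fun_tnthP; apply. Qed.

Lemma measurable_dotp f g : measurable_fun setT f -> measurable_fun setT g ->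
  measurable_fun setT (fun w => dotp (f w) (g w)).
Proof.
move=> mf mg; apply: measurable_sum => i.
by apply: measurable_funM; exact: measurable_tnth_comp.
Qed.

Lemma measurable_vsub f g : measurable_fun setT f -> measurable_fun setT g ->
  measurable_fun setT (fun w => vsub (f w) (g w)).
Proof.
move=> mf mg; apply/measurable_fun_tnthP => i.
apply: (@eq_measurable_fun _ _ _ _ _ (fun w => tnth (f w) i - tnth (g w) i)).
  by move=> w _ /=; rewrite tnth_mktuple.
by apply: measurable_funB; exact: measurable_tnth_comp.
Qed.

Lemma measurable_enorm f : measurable_fun setT f ->
  measurable_fun setT (fun w => enorm (f w)).
Proof.
move=> mf; have msqrt : measurable_fun [set: R] (@Num.sqrt R).
  by apply: continuous_measurable_fun; exact: sqrt_continuous.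
have msum : measurable_fun setT (fun w => \sum_(i < k) tnth (f w) i ^+ 2).
  apply: measurable_sum => i.
  by apply: measurable_funX; exact: measurable_tnth_comp.
exact: (measurableT_comp msqrt msum).
Qed.

Lemma measurable_all {I : Type} (P : T -> pred I) (s : seq I) :
  (forall x, measurable_fun setT (P ^~ x)) ->
  measurable_fun setT (fun w => all (P w) s).
Proof.
by move=> mP; elim: s => //= x s IH; exact: measurable_and.
Qed.

Lemma measurable_has {I : Type} (P : T -> pred I) (s : seq I) :
  (forall x, measurable_fun setT (P ^~ x)) ->
  measurable_fun setT (fun w => has (P w) s).
Proof.
by move=> mP; elim: s => //= x s IH; exact: measurable_or.
Qed.

Lemma measurable_opt_ext (ext : seq (k.-tuple R)) f z : measurable_fun setT f ->
  measurable_fun setT (fun w => opt_ext ext (f w) z).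
Proof.
move=> mf; apply: measurable_all => x.
by apply: measurable_fun_ler; exact: measurable_dotp.
Qed.

Lemma measurable_nth_find {d'} {V : measurableType d'} (x0 : V) (P : T -> pred V)
    (s : seq V) : (forall x, measurable_fun setT (P ^~ x)) ->
  measurable_fun setT (fun w => nth x0 s (find (P w) s)).
Proof.
move=> mP; elim: s => [|x s IH] //=.
apply: (@eq_measurable_fun _ _ _ _ _
    (fun w => if P w x then x else nth x0 s (find (P w) s))).
  by move=> w _; case: ifP.
exact: measurable_fun_ifT.
Qed.

End measurability.

(** * Peeling: summing the contributions of the error shells *)

Section peeling.
Context d (Omega : measurableType d) (R : realType) (P : probability Omega R).

(** Pointwise, [f] is at most the sum over [k] of [c k] times the indicator of [A k]. Integrating
    term by term leaves a series dominated by a geometric one. *)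
Lemma peeling_le (f : Omega -> R) (A : nat -> set Omega) (c p : nat -> R) (L r : R) :
  measurable_fun setT f -> (forall w, 0 <= f w) ->
  (forall k, measurable (A k)) -> (forall k, 0 <= c k) -> 0 <= r < 1 ->
  (forall w, 0 < f w -> exists2 k, A k w & f w <= c k) ->
  (forall k, (P (A k) <= (p k)%:E)%E) -> (forall k, c k * p k <= L * r ^+ k) ->
  (\int[P]_w (f w)%:E <= (L / (1 - r))%:E)%E.
Proof.
move=> mf f0 mA c0 /andP[r0 r1] fA PA cp.
have mI k : measurable_fun setT (fun w => (c k * \1_(A k) w)%:E).
  by apply/measurable_EFinP; apply: measurable_funM.
have I0 k w : (0 <= (c k * \1_(A k) w)%:E)%E by rewrite lee_fin mulr_ge0// indicE.
apply: (@le_trans _ _ (\int[P]_w \big[+%E/0%E]_(0 <= k <oo) (c k * \1_(A k) w)%:E)%E).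
  apply: ge0_le_integral => //.
  - by move=> w _; rewrite lee_fin.
  - exact/measurable_EFinP.
  - by apply: (@ge0_emeasurable_sum _ _ _ _ _ xpredT) => // k _.
  - move=> w _; have [fw0|/fA[k Akw fk]] := leP (f w) 0.
      by apply: (@le_trans _ _ 0%E); rewrite ?lee_fin// nneseries_ge0.
    apply: le_trans (nneseries_lim_ge k.+1 _) => //.
    rewrite big_nat_recr//= -[leLHS]add0e leeD//; first by rewrite sume_ge0.
    by rewrite indicE mem_set// mulr1 lee_fin.
rewrite integral_nneseries//.
apply: (@le_trans _ _ (\big[+%E/0%E]_(0 <= k <oo) (L * r ^+ k)%:E)).
  apply: lee_nneseries => [k _ _|k _]; first exact: integral_ge0.
  under eq_integral do rewrite EFinM.
  rewrite ge0_integralZl ?lee_fin//; last exact/measurable_EFinP.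
  rewrite integral_indic// setIT.
  apply: (@le_trans _ _ ((c k)%:E * (p k)%:E)%E).
    by rewrite lee_pmul ?lee_fin ?c0 ?PA.
  by rewrite -EFinM lee_fin.
suff -> : \big[+%E/0%E]_(0 <= k <oo) (L * r ^+ k)%:E = (L / (1 - r))%:E by [].
have rlt1 : `|r| < 1 by rewrite ger0_norm.
apply: cvg_lim => //.
have -> : (fun n => \sum_(0 <= k < n) (L * r ^+ k)%:E)%E =
    EFin \o series (geometric L r) by apply/funext => n; rewrite /= sumEFin.
apply: cvg_EFin; last exact: cvg_geometric_series.
exact: nearW.
Qed.

End peeling.

(* [x <= exp (x - 1)] absorbs the polynomial factor, then complete the square *)
Lemma powR_gauss_le_geometric {R : realType} (s C : R) (k : nat) : 0 <= s -> 0 < C ->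
  k.+1%:R `^ s * expR (- C * k%:R ^+ 2) <=
  expR ((s + 1) ^+ 2 / (4 * C)) * expR (-1) ^+ k.
Proof.
move=> s0 C0.
have ks : k.+1%:R `^ s <= expR (s * k%:R).
  rewrite mulrC expRM; apply: ge0_ler_powR => //; rewrite ?nnegrE ?expR_ge0//.
  by rewrite -natr1 addrC expR_ge1Dx.
apply: (@le_trans _ _ (expR (s * k%:R) * expR (- C * k%:R ^+ 2))).
  by rewrite ler_wpM2r ?expR_ge0.
rewrite -expRM_natl -!expRD ler_expR; set x : R := k%:R.
have -> : (s + 1) ^+ 2 / (4 * C) = s * x - C * x ^+ 2 + x +
    C * (x - (s + 1) / (2 * C)) ^+ 2.
  by field; rewrite gt_eqF.
by have := mulr_ge0 (ltW C0) (sqr_ge0 (x - (s + 1) / (2 * C))); lra.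
Qed.

Lemma measurable_setb {d} {T : measurableType d} (f : T -> bool) :
  measurable_fun setT f -> measurable [set x | f x].
Proof.
move=> mf; rewrite -[X in measurable X]setTI.
exact: (mf measurableT [set true]).
Qed.

(** * Measurability of the plug-in policy and of the margin event *)

Section plugin_measurability.
Context {d} {T : measurableType d} {R : realType} {m k : nat} (A : 'M[R]_(m, k))
  (b : 'I_m -> R) (B : R) (ext : seq (k.-tuple R)).
Local Notation S := (polytope A b).
Hypothesis S_bounded : forall z, S z -> enorm z <= B.
Hypothesis extP : forall z, z \in ext <-> extreme_point S z.
Hypothesis S_neq0 : exists z, S z.
Variable f : T -> k.-tuple R.
Hypothesis mf : measurable_fun setT f.

Lemma measurable_plugin : measurable_fun setT (fun w => plugin S ext (f w)).
Proof.
apply: (@eq_measurable_fun _ _ _ _ _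
    (fun w => nth [tuple of nseq k 0] ext (find (opt_ext ext (f w)) ext))).
  by move=> w _; rewrite -(pluginE S_bounded extP).
by apply: measurable_nth_find => z; exact: measurable_opt_ext.
Qed.

Lemma measurable_gap_itv c : measurable [set w | 0 < gap S ext (f w) <= c].
Proof.
apply: measurable_setb; apply: eq_measurable_fun.
  by move=> w _; rewrite (gap_itvE S_bounded extP S_neq0).
apply: measurable_has => z; apply: measurable_and.
  by apply: measurable_neg; exact: measurable_opt_ext.
apply: measurable_has => z'; apply: measurable_and; first exact: measurable_opt_ext.
apply: measurable_fun_ler => //.
by apply: measurable_funB; exact: measurable_dotp.
Qed.

End plugin_measurability.

(** * The regret bound, by peeling at scale [a ^ (-1/2)] *)

Theorem theorem8 (R : realType) (C1 C2 : R) (hC1 : 0 < C1) (hC2 : 0 < C2)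
  (alpha gamma : R) (halpha : 0 <= alpha) (hgamma : 0 <= gamma) :
  exists C : R,
  forall (p dd m n : nat)
    (A : 'M[R]_(m, dd)) (b : 'I_m -> R) (B : R)
    (ext : seq (dd.-tuple R))
    (d0 : measure_display) (Omega : measurableType d0)
    (P : probability Omega R)
    (X : Omega -> p.-tuple R) (Y : Omega -> dd.-tuple R)
    (Dat : 'I_n -> Omega -> (p.-tuple R * dd.-tuple R)%type)
    (est : n.-tuple (p.-tuple R * dd.-tuple R)%type -> p.-tuple R -> dd.-tuple R)
    (fstar pistar : p.-tuple R -> dd.-tuple R)
    (a : R),
  (* the polytope Z, bounded by B, and its extreme points listed in a fixed order *)
  0 < B ->
  (forall z, polytope A b z -> enorm z <= B) ->
  uniq ext ->
  (forall z, z \in ext <-> extreme_point (polytope A b) z) ->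
  (* the new draw (X, Y), with ||Y|| <= 1 *)
  measurable_fun [set: Omega] X ->
  measurable_fun [set: Omega] Y ->
  (forall w, enorm (Y w) <= 1) ->
  (* data: n draws, i.i.d. with the same law as (X, Y), independent of (X, Y) *)
  (forall i, measurable_fun [set: Omega] (Dat i)) ->
  mutually_independent P
    (fun o : option 'I_n => match o with
                            | Some i => Dat i
                            | None => fun w => (X w, Y w)
                            end) ->
  (forall i (S : set (p.-tuple R * dd.-tuple R)%type), measurable S ->
     P (Dat i @^-1` S) = P ((fun w => (X w, Y w)) @^-1` S)) ->
  (* the estimator is a (jointly measurable) function of the data *)
  measurable_fun [set: (n.-tuple (p.-tuple R * dd.-tuple R)%type * p.-tuple R)%type]
    (fun q => est q.1 q.2) ->
  (* f^* = E[Y | X = .], and pi^* a (measurable) selection of Z^*(.) *)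
  is_cond_exp P X Y fstar ->
  measurable_fun [set: p.-tuple R] pistar ->
  (forall x, argmin_set (polytope A b) (fstar x) (pistar x)) ->
  (* noise (margin) condition *)
  (forall delta : R, 0 < delta ->
     (P [set w | (0 < gap (polytope A b) ext (fstar (X w)) <= delta)%R]
      <= ((gamma * delta / B) `^ alpha)%:E)%E) ->
  (* sub-Gaussian concentration of the estimator, for a.e. x *)
  0 < a ->
  (forall delta : R, 0 < delta ->
     {ae pushforward P X, forall x : p.-tuple R,
       (P [set w | (delta <= enorm (vsub (est [tuple Dat i w | i < n] x) (fstar x)))%R]
        <= (C1 * expR (- C2 * a * delta ^+ 2))%:E)%E}) ->
  (* regret bound *)
  (\int[P]_w (dotp (fstar (X w))
       (vsub (plugin (polytope A b) ext (est [tuple Dat i w | i < n] (X w)))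
             (pistar (X w))))%:E
   <= (C * B * a `^ (- ((1 + alpha) / 2)))%:E)%E.
Proof.
(* [M] is the constant of [powR_gauss_le_geometric] for the exponent [1 + alpha] and the rate [C2];
   [1 - expR (-1)] comes from summing the geometric series. *)
pose M := expR ((1 + alpha + 1) ^+ 2 / (4 * C2)).
exists (2 * (C1 + 1) * (2 * gamma) `^ alpha * M / (1 - expR (-1))).
move=> p dd m n A b B ext d0 Omega P X Y Dat est fstar pistar a B0 Bbound _ extP
  mX mY _ mDat indep _ mest [mfstar _] mpistar pistar_opt noise a0 conc.
have S0 : exists z, polytope A b z.
  by exists (pistar [tuple 0 | i < p]); case: (pistar_opt [tuple 0 | i < p]).
pose Dt w := [tuple Dat i w | i < n].
have mDt : measurable_fun setT Dt.
  apply/measurable_fun_tnthP => i; apply: eq_measurable_fun (mDat i) => w _ /=.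
  by rewrite tnth_mktuple.
have indepXD : forall U V, measurable U -> measurable V ->
    P (X @^-1` U `&` Dt @^-1` V) = (P (X @^-1` U) * P (Dt @^-1` V))%E.
  have mXY : measurable_fun setT (fun w => (X w, Y w)) by exact: measurable_fun_pair.
  exact: (mutually_independent_tuple mDat mXY measurable_fst indep).
pose err x D := enorm (vsub (est D x) (fstar x)).
have merr : measurable_fun setT (fun q => err q.1 q.2).
  apply: measurable_enorm; apply: measurable_vsub.
    exact: (measurableT_comp mest (measurable_fun_pair measurable_snd measurable_fst)).
  exact: (measurableT_comp mfstar measurable_fst).
have mXD : measurable_fun setT (fun w => (X w, Dt w)) by exact: measurable_fun_pair.
(* errors are measured in units of [t = a ^ (-1/2)] *)
pose t : R := a `^ (- 2^-1).
have t0 : 0 < t by exact: powR_gt0.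
have at2 : a * t ^+ 2 = 1.
  rewrite -powR_mulrn ?powR_ge0// -powRrM.
  rewrite (_ : - 2^-1 * 2%:R = -1) ?powR_inv1 ?ltW ?divff ?gt_eqF//.
  by field.
pose G k : set (p.-tuple R) :=
  [set x | 0 < gap (polytope A b) ext (fstar x) <= 2 * B * (k.+1%:R * t)].
have mG k : measurable (G k) by exact: (measurable_gap_itv Bbound extP S0 mfstar).
pose H k : set (p.-tuple R * n.-tuple (p.-tuple R * dd.-tuple R)) :=
  [set q | k%:R * t <= err q.1 q.2].
have mH k : measurable (H k).
  by apply: measurable_setb; exact: measurable_fun_ler.
(* The concentration bound requires a positive threshold, which excludes [k = 0]. Using [C1 + 1] in
   place of [C1] gives [1 <= q 0], so the trivial bound covers that case. *)
pose q k := (C1 + 1) * expR (- C2 * k%:R ^+ 2).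
have aeX : Filter (almost_everywhere (pushforward P X)).
  pose X' : {mfun Omega >-> p.-tuple R} :=
    HB.pack X (isMeasurableFun.Build _ _ _ _ _ mX).
  exact: (ae_filter_ringOfSetsType (distribution P X')).
have PA k : (P [set w | G k (X w) /\ H k (X w, Dt w)] <=
    (q k * (2 * gamma * (k.+1%:R * t)) `^ alpha)%:E)%E.
  have q0 : 0 <= q k by rewrite mulr_ge0 ?expR_ge0// addr_ge0// ltW.
  apply: (@le_trans _ _ ((q k)%:E * P (X @^-1` G k))%E).
    apply: (independent_section_le mX mDt indepXD (mH k) (mG k) q0).
    have [->|k0] := eqVneq k 0%N.
      have q1 : 1 <= q 0%N by rewrite /q expr0n mulr0 expR0 mulr1 lerDr ltW.
      apply: filterE => x; rewrite [X in P X](_ : _ = setT).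
        by rewrite probability_setT lee_fin.
      by apply/seteqP; split=> // w _; rewrite /H/= mul0r enorm_ge0.
    have kt0 : 0 < k%:R * t by rewrite mulr_gt0// ltr0n lt0n.
    move: (conc _ kt0).
    apply: filterS => x /le_trans; apply.
    (* Since [a * t ^+ 2 = 1], the exponent no longer involves [a]. *)
    have -> : - C2 * a * (k%:R * t) ^+ 2 = - C2 * k%:R ^+ 2 * (a * t ^+ 2) by ring.
    by rewrite at2 mulr1 lee_fin ler_wpM2r ?expR_ge0// lerDl.
  rewrite [leRHS]EFinM lee_wpmul2l ?lee_fin//.
  (* The factor [B] in this threshold cancels the division by [B] in the margin condition. *)
  have := noise (2 * B * (k.+1%:R * t)); rewrite !mulr_gt0// => /(_ isT) /le_trans; apply.
  rewrite lee_fin le_eqVlt; apply/orP; left; apply/eqP; congr (_ `^ _).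
  by field; rewrite gt_eqF.
have -> : 2 * (C1 + 1) * (2 * gamma) `^ alpha * M / (1 - expR (-1)) * B *
    a `^ (- ((1 + alpha) / 2)) =
    (2 * B * (C1 + 1) * (2 * gamma) `^ alpha * M * a `^ (- ((1 + alpha) / 2))) /
    (1 - expR (-1)) by ring.
pose reg w := dotp (fstar (X w))
  (vsub (plugin (polytope A b) ext (est (Dt w) (X w))) (pistar (X w))).
rewrite -/(reg _).
apply: (@peeling_le _ _ _ _ reg
   (fun k => [set w | G k (X w) /\ H k (X w, Dt w)])
   (fun k => 2 * B * (k.+1%:R * t))
   (fun k => q k * (2 * gamma * (k.+1%:R * t)) `^ alpha)) => //.
- apply: measurable_dotp; first exact: (measurableT_comp mfstar mX).
  apply: measurable_vsub; last exact: (measurableT_comp mpistar mX).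
  apply: (measurable_plugin Bbound extP).
  exact: (measurableT_comp mest (measurable_fun_pair mDt mX)).
- move=> w; apply: regret_ge0; first exact: pistar_opt.
  by case: (plugin_argmin Bbound extP S0 (est (Dt w) (X w))).
- move=> k.
  have := mXD measurableT _ (measurableI _ _ (measurableX (mG k) measurableT) (mH k)).
  rewrite setTI; congr (measurable _); apply/seteqP; split=> w /=; tauto.
- by move=> k; rewrite !mulr_ge0// ltW.
- by rewrite expR_ge0/= expR_lt1 oppr_lt0 ltr01.
- move=> w reg0.
  have /andP[g0 gle] := regret_gap Bbound extP S0 (pistar_opt _) reg0.
  have e0 : 0 <= err (X w) (Dt w) / t by rewrite divr_ge0 ?enorm_ge0// ltW.
  (* The shell index [k] is the integer part of [err / t], so that [k * t <= err < (k + 1) * t]: the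
     lower bound gives [H k], the upper one [G k] and the cost. *)
  have /andP[k1 k2] := truncn_itv e0.
  have le2 : 2 * B * err (X w) (Dt w) <=
      2 * B * ((Num.truncn (err (X w) (Dt w) / t)).+1%:R * t).
    by rewrite ler_pM2l ?mulr_gt0// -ler_pdivrMr// ltW.
  exists (Num.truncn (err (X w) (Dt w) / t)).
    split; first by rewrite /G/= g0 (le_trans gle).
    by rewrite /H/= -ler_pdivlMr.
  by apply: le_trans le2; exact: regret_le.
- move=> k.
  rewrite /q !powRM ?mulr_ge0 ?(ltW t0)//.
  (* The cost brings [(k + 1) * t] and the margin condition its power [alpha]. Together they give
     [t] to the power [1 + alpha], which is the rate, and a power of [k + 1] absorbed by the
     Gaussian factor. *)
  have -> : 2 * B * (k.+1%:R * t) * ((C1 + 1) * expR (- C2 * k%:R ^+ 2) *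
      (2 `^ alpha * gamma `^ alpha * (k.+1%:R `^ alpha * t `^ alpha))) =
      2 * B * (C1 + 1) * (2 `^ alpha * gamma `^ alpha) * (t * t `^ alpha) *
      (k.+1%:R * k.+1%:R `^ alpha * expR (- C2 * k%:R ^+ 2)) by ring.
  have powR1D (x : R) : 0 < x -> x * x `^ alpha = x `^ (1 + alpha).
    by move=> x0; rewrite powRD ?powRr1 ?ltW// lt0r_neq0// implybT.
  have -> : a `^ (- ((1 + alpha) / 2)) = t `^ (1 + alpha).
    by rewrite -powRrM; congr (_ `^ _); field.
  rewrite !powR1D//.
  have -> : 2 * B * (C1 + 1) * (2 `^ alpha * gamma `^ alpha) * M * t `^ (1 + alpha) *
      expR (-1) ^+ k = 2 * B * (C1 + 1) * (2 `^ alpha * gamma `^ alpha) *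
      t `^ (1 + alpha) * (M * expR (-1) ^+ k) by ring.
  rewrite ler_wpM2l ?mulr_ge0 ?powR_ge0 ?addr_ge0 ?(ltW B0) ?(ltW hC1)//.
  by apply: powR_gauss_le_geometric; rewrite ?addr_ge0.
Qed.
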